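(* Let $M$ be a hypersurface in $\mathbb{R}^{n+1}$, $n\geq 2$, with first fundamental form $g$ and second fundamental form $b$, and suppose that $b$ has rank $n$ (everywhere). Let $\nabla$ and $\overline{\nabla}$ be the Levi-Civita connections of $g$ and $b$, respectively, and let $A=\overline{\nabla}-\nabla$. Then $(M,b,A)$ is a formal Frobenius structure, i.e. $b(A(X,Y),Z)=b(X,A(Y,Z))$ and $A(X,Y)=A(Y,X)$ for all vector fields $X,Y,Z$ on $M$.
   Context: $M$ is a smooth $n$-dimensional hypersurface of Euclidean space $\mathbb{R}^{n+1}$; $g$ is the induced Riemannian metric and $b$ is the second fundamental form with respect to a unit normal field. Since $b$ is a nondegenerate symmetric $(0,2)$-tensor field (possibly indefinite), it has a Levi-Civita connection: the unique torsion-free linear connection $\overline{\nabla}$ with $\overline{\nabla}b=0$. The difference of connections is the tensor field $A(X,Y)=\overline{\nabla}_XY-\nabla_XY$ of type $(1,2)$. *)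

(* Defs.v *)
From mathcomp Require Import all_boot all_order all_algebra.
From mathcomp Require Import all_classical all_reals all_analysis.

Set Implicit Arguments.
Unset Strict Implicit.
Unset Printing Implicit Defensive.

Import Order.TTheory GRing.Theory Num.Theory.
Import numFieldNormedType.Exports.

Local Open Scope classical_set_scope.
Local Open Scope ring_scope.

Section Smooth.
Context {R : realType} {V W : normedModType R}.

Fixpoint Ck_on (k : nat) (U : set V) (h : V -> W) : Prop :=
  match k with
  | 0 => forall x, U x -> {for x, continuous h}
  | k'.+1 => (forall x, U x -> differentiable h x) /\
             (forall v, Ck_on k' U (fun x => 'd h x v))
  end.

(* C^oo on U; only used for open U. *)
Definition smooth_on (U : set V) (h : V -> W) : Prop :=
  forall k, Ck_on k U h.

End Smooth.

Definition dot {R : realType} {m : nat} (u v : 'rV[R]_m) : R :=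
  \sum_(i < m) u 0 i * v 0 i.

(* A hypersurface is a manifold M with an immersion f : M -> R^(n+1); for an
   embedded hypersurface, M is a subset of R^(n+1) with the subspace topology
   and f is the inclusion.  The smooth structure need not be given separately,
   since f determines it: if M has a smooth structure for which f is an
   immersion, then its charts are exactly the topological charts of M in which
   f reads as a smooth immersion.
   Tangent vectors at p are identified with their images under df_p, so that
   T_pM is a subspace of R^(n+1) and vector fields are maps M -> R^(n+1). *)
Section Hypersurface.
Context {R : realType} {n : nat} {M : topologicalType}.
Variable f : M -> 'rV[R]_n.+1.

(* Charts are given by the parametrization psi : V -> M; the values of psi
   outside V are irrelevant. *)
Definition is_chart (V : set 'rV[R]_n) (psi : 'rV[R]_n -> M) : Prop :=
  [/\ open V,
      {in V &, injective psi},
      (forall x, V x -> {for x, continuous psi}),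
      (forall U, open U -> U `<=` V -> open (psi @` U)) &
      smooth_on V (f \o psi) /\
      (forall x, V x -> injective ('d (f \o psi) x))].

Definition is_hypersurface : Prop :=
  [/\ hausdorff_space M,
      @second_countable M &
      forall p : M, exists V psi, is_chart V psi /\ (psi @` V) p].

Definition smooth {W : normedModType R} (h : M -> W) : Prop :=
  forall V psi, is_chart V psi -> smooth_on V (h \o psi).

Definition tangent (p : M) (v : 'rV[R]_n.+1) : Prop :=
  exists V psi x, [/\ is_chart V psi, V x, psi x = p &
    exists u, 'd (f \o psi) x u = v].

(* dh_p(v), computed in any chart around p (the value does not depend on it
   when h is smooth); it is 0 by convention when v is not tangent at p. *)
Definition tdiff {W : normedModType R} (h : M -> W) (p : M)
    (v : 'rV[R]_n.+1) : W :=
  xget 0 [set w | exists V psi x u,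
    [/\ is_chart V psi, V x, psi x = p,
        'd (f \o psi) x u = v & 'd (h \o psi) x u = w]].

Definition vector_field (X : M -> 'rV[R]_n.+1) : Prop :=
  smooth X /\ forall p, tangent p (X p).

(* The function X h. *)
Definition dirder {W : normedModType R} (X : M -> 'rV[R]_n.+1) (h : M -> W) :
    M -> W :=
  fun p => tdiff h p (X p).

Definition unit_normal (N : M -> 'rV[R]_n.+1) : Prop :=
  [/\ smooth N,
      forall p, dot (N p) (N p) = 1 &
      forall p v, tangent p v -> dot (N p) v = 0].

(* (0,2)-tensor fields; only the values on tangent vectors matter. *)
Definition bilin_field := M -> 'rV[R]_n.+1 -> 'rV[R]_n.+1 -> R.

(* f^*<.,.>: it is the restriction of the dot product because tangent vectors
   are already identified with vectors of R^(n+1). *)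
Definition first_form : bilin_field := fun _ v w => dot v w.

(* b(v, w) = - <dN(v), w>, i.e. D_X Y = nabla_X Y + b(X, Y) N. *)
Definition second_form (N : M -> 'rV[R]_n.+1) : bilin_field :=
  fun p v w => - dot (tdiff N p v) w.

(* Rank of a bilinear form on T_pM, through its matrix in the coordinate basis
   of a chart around p. *)
Definition has_rank_at (beta : bilin_field) (p : M) (r : nat) : Prop :=
  forall V psi x, is_chart V psi -> V x -> psi x = p ->
    let e i := 'd (f \o psi) x (delta_mx 0 i) in
    \rank (\matrix_(i < n, j < n) beta p (e i) (e j)) = r.

Definition operator :=
  (M -> 'rV[R]_n.+1) -> (M -> 'rV[R]_n.+1) -> M -> 'rV[R]_n.+1.

(* Only the values nabla X Y on vector fields X, Y matter. *)
Definition linear_connection (nabla : operator) : Prop :=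
  (forall X Y, vector_field X -> vector_field Y -> vector_field (nabla X Y)) /\
  [/\ (forall X1 X2 Y,
         vector_field X1 -> vector_field X2 -> vector_field Y ->
         nabla (X1 \+ X2) Y = nabla X1 Y \+ nabla X2 Y),
      (forall (h : M -> R) X Y,
         smooth h -> vector_field X -> vector_field Y ->
         nabla (fun p => h p *: X p) Y = fun p => h p *: nabla X Y p),
      (forall X Y1 Y2,
         vector_field X -> vector_field Y1 -> vector_field Y2 ->
         nabla X (Y1 \+ Y2) = nabla X Y1 \+ nabla X Y2) &
      (forall (h : M -> R) X Y,
         smooth h -> vector_field X -> vector_field Y ->
         nabla X (fun p => h p *: Y p) =
         fun p => dirder X h p *: Y p + h p *: nabla X Y p)].

(* nabla_X Y - nabla_Y X = [X, Y], where [X, Y] is the vector field acting on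
   functions by X o Y - Y o X. *)
Definition torsion_free (nabla : operator) : Prop :=
  forall X Y (h : M -> R), vector_field X -> vector_field Y -> smooth h ->
    forall p, dirder (nabla X Y \- nabla Y X) h p =
              dirder X (dirder Y h) p - dirder Y (dirder X h) p.

(* nabla beta = 0 *)
Definition parallel (beta : bilin_field) (nabla : operator) : Prop :=
  forall X Y Z, vector_field X -> vector_field Y -> vector_field Z ->
    forall p, dirder X (fun q => beta q (Y q) (Z q)) p =
              beta p (nabla X Y p) (Z p) + beta p (Y p) (nabla X Z p).

Definition levi_civita (beta : bilin_field) (nabla : operator) : Prop :=
  [/\ linear_connection nabla, torsion_free nabla & parallel beta nabla].

Definition formal_frobenius (beta : bilin_field) (A : operator) : Prop :=
  forall X Y Z, vector_field X -> vector_field Y -> vector_field Z ->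
    (forall p, beta p (A X Y p) (Z p) = beta p (X p) (A Y Z p)) /\
    (forall p, A X Y p = A Y X p).

End Hypersurface.

(* Main.v *)
Require Import Defs.
From HB Require Import structures.
From mathcomp Require Import all_boot all_order all_algebra.
From mathcomp Require Import all_classical all_reals all_analysis.
From mathcomp Require Import ring lra.
Import numFieldNormedType.Exports.
Import Order.TTheory GRing.Theory Num.Theory.
Local Open Scope classical_set_scope.
Local Open Scope ring_scope.

Set Implicit Arguments.
Unset Strict Implicit.
Unset Printing Implicit Defensive.

(* Let [D] be the flat derivative of R^(n+1)-valued maps.  The Koszul argument
   gives the Gauss formula [nabla_X Y = D_X Y - <N, D_X Y> N], hence the Codazzi
   equation for [b = - <DN, .>].  Since [nablabar] is parallel for [b] and both
   connections are torsion-free, Codazzi reads [b(Y, A(X, Z)) = b(X, A(Y, Z))];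
   with the symmetry of [A] and [b] this is the Frobenius identity.
   Global test fields are the projections [e_i - N_i N] of constant vectors, so
   no bump functions are needed, and [D_X D_Y N - D_Y D_X N = D_[X,Y] N] is
   torsion-freeness tested on the coordinates of [N]. *)

(** * Fréchet differentials: estimates, germs and Leibniz rules *)

Section Differential.
Context {R : realType}.

Lemma diff_eps {V W : normedModType R} (h : V -> W) (x : V) :
  differentiable h x -> forall e : R, 0 < e ->
  \forall y \near x, `|h y - h x - 'd h x (y - x)| <= e * `|y - x|.
Proof.
move=> dh e e0; have /diff_locally/eqaddoP/(_ e e0) := dh.
rewrite [in X in _ -> X](near_shift 0 x) subr0 /=; apply: filterS => z /=.
by rewrite !fctE /= /cst /shift /= addrK opprD addrA.
Qed.

(** Continuity of [L] is assumed because it is part of Fréchet differentiability and is not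
    automatic in infinite dimension. *)
Lemma is_diff_eps {V W : normedModType R} (h : V -> W) (L : {linear V -> W})
    (x : V) : continuous L ->
  (forall e : R, 0 < e ->
    \forall y \near x, `|h y - h x - L (y - x)| <= e * `|y - x|) ->
  is_diff x h L.
Proof.
move=> cL hL; have hoL : h \o shift x = cst (h x) + L +o_ 0 id.
  apply/eqaddoP => e e0.
  have := hL e e0; rewrite (near_shift 0 x) subr0; apply: filterS => z /=.
  by rewrite !fctE /= /cst /shift /= addrK opprD addrA.
have dhE := diff_unique cL hoL.
by split=> //; apply/diff_locallyP; rewrite dhE.
Qed.

Lemma is_diff_near {V W : normedModType R} (h g : V -> W) (x : V) :
  (\forall y \near x, h y = g y) -> differentiable h x ->
  is_diff x g ('d h x).
Proof.
move=> hg dh; apply: is_diff_eps => [|e e0]; first exact: diff_continuous.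
have hgx := nbhs_singleton hg.
by have := diff_eps dh e0; apply: filterS2 hg => y <-; rewrite hgx.
Qed.

(* [h (tau y) - h x = tau y - x + o(tau y - x)] makes [tau] Lipschitz at [x'],
   so that the error is also [o(y - x')]. *)
Lemma differentiable_inverse {U V : normedModType R} (h : V -> V)
    (tau : U -> V) (k : U -> V) (x' : U) (x : V) :
  is_diff x h id -> {for x', continuous tau} -> tau x' = x ->
  (\forall y \near x', h (tau y) = k y) -> differentiable k x' ->
  differentiable tau x'.
Proof.
move=> dh ctau tx' hk dk.
have dck := diff_continuous dk.
have [C C0 LC] := linear_lipschitz dck.
have near_h (e : R) : 0 < e -> \forall y \near x',
    `|k y - k x' - (tau y - tau x')| <= e * `|tau y - tau x'|.
  move=> e0.
  have /(_ e e0) := diff_eps (@ex_diff _ _ _ _ _ _ _ dh).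
  rewrite -tx' => /ctau H.
  have {}H : \forall y \near x', `|h (tau y) - h (tau x') -
      'd h (tau x') (tau y - tau x')| <= e * `|tau y - tau x'| by [].
  have hkx := nbhs_singleton hk; apply: filterS2 H hk => y.
  by rewrite hkx tx' diff_val => + <-.
have near_tau : \forall y \near x', `|tau y - tau x'| <= 2 * (C + 1) * `|y - x'|.
  (* The error factor 1/2 lets the term in [tau] be absorbed on the left; with $|k y - k x'| \le
     (C+1)|y - x'|$ this gives the constant $2(C+1)$. *)
  have half_gt0 : 0 < 2^-1 :> R by rewrite invr_gt0 ltr0n.
  apply: filterS2 (near_h _ half_gt0) (diff_eps dk ltr01) => y Hy Hk.
  have Hn := LC (y - x').
  have := ler_normB (k y - k x') (k y - k x' - (tau y - tau x')).
  rewrite subKr => H2.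
  have := ler_normD (k y - k x' - 'd k x' (y - x')) ('d k x' (y - x')).
  rewrite subrK => H3.
  by lra.
suff : is_diff x' tau ('d k x') by move=> ?; apply: ex_diff.
apply: is_diff_eps => // e e0.
(* The Lipschitz bound on [tau] turns this factor into $e/2$; the other $e/2$ goes to the expansion
   of [k]. *)
have eC : 0 < e / 2 / (2 * (C + 1)).
  by rewrite divr_gt0 ?divr_gt0 ?mulr_gt0 //; lra.
have e2 : 0 < e / 2 by rewrite divr_gt0.
near=> y.
have H1 : `|k y - k x' - (tau y - tau x')| <=
  e / 2 / (2 * (C + 1)) * `|tau y - tau x'| by near: y; exact: near_h.
have H2 : `|tau y - tau x'| <= 2 * (C + 1) * `|y - x'| by near: y.
have H3 : `|k y - k x' - 'd k x' (y - x')| <= e / 2 * `|y - x'|.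
  by near: y; exact: diff_eps.
have H4 : `|k y - k x' - (tau y - tau x')| <= e / 2 * `|y - x'|.
  apply: (le_trans H1); apply: (le_trans (ler_wpM2l (ltW eC) H2)).
  by rewrite mulrA divfK // gt_eqF //; lra.
have := ler_normB (k y - k x' - 'd k x' (y - x')) (k y - k x' - (tau y - tau x')).
rewrite opprB addrC.
have -> : tau y - tau x' - (k y - k x') + (k y - k x' - 'd k x' (y - x')) =
  tau y - tau x' - 'd k x' (y - x') by rewrite addrA subrK.
by lra.
Unshelve. all: by end_near. Qed.

(** The chain rule through the pair of [h] and [k]. Both Leibniz rules below, for scaling and for
    [dot], are instances. *)
Lemma is_diff_bilinear {U V V' W : normedModType R}
    (B : {bilinear V -> V' -> W}) (h : U -> V) (k : U -> V') (x : U) :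
  continuous (fun p => B p.1 p.2) -> differentiable h x ->
  differentiable k x ->
  is_diff x (fun y => B (h y) (k y))
    (fun v => B (h x) ('d k x v) + B ('d h x v) (k x)).
Proof.
move=> cB dh dk; have dhk := differentiable_pair dh dk.
have dB := differentiable_bilin (h x, k x) cB.
split; first exact: (differentiable_comp dhk dB).
by rewrite (diff_comp dhk dB) diff_bilin // diff_pair.
Qed.

Lemma scale_is_bilinear (W : normedModType R) :
  bilinear_for (GRing.Scale.Law.clone _ _ *:%R _)
    (GRing.Scale.Law.clone _ _ *:%R _) (fun (a : R) (w : W) => a *: w).
Proof.
split=> [w|b] a x y /=; first by rewrite scalerDl scalerA.
by rewrite scalerDr !scalerA mulrC.
Qed.

Lemma is_diff_scale {U W : normedModType R} (a : U -> R) (h : U -> W) (x : U) :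
  differentiable a x -> differentiable h x ->
  is_diff x (fun y => a y *: h y) (fun v => a x *: 'd h x v + 'd a x v *: h x).
Proof.
pose B : {bilinear R -> W -> W} := HB.pack (fun (a : R) (w : W) => a *: w)
  (bilinear_isBilinear.Build _ _ _ _ _ _ _ (scale_is_bilinear W)).
by apply: (@is_diff_bilinear _ _ _ _ B) => p; exact: scale_continuous.
Qed.

Lemma dot_is_bilinear m :
  bilinear_for (GRing.Scale.Law.clone _ _ *:%R _)
    (GRing.Scale.Law.clone _ _ *:%R _) (@dot R m).
Proof.
split=> [w|w] a x y /=; rewrite /dot scaler_sumr -big_split /=;
  apply: eq_bigr => i _; rewrite !mxE; rewrite /GRing.scale /=; ring.
Qed.

Lemma dot_continuous m :
  continuous (fun p : 'rV[R]_m * 'rV[R]_m => dot p.1 p.2).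
Proof.
move=> p; rewrite /dot; apply: cvg_big => [|i _]; first exact: add_continuous.
pose c (v : 'rV[R]_m) := v 0 i.
apply: (@continuousM _ _ (c \o fst) (c \o snd)).
  by apply: continuous_comp; [exact: cvg_fst | exact: coord_continuous].
by apply: continuous_comp; [exact: cvg_snd | exact: coord_continuous].
Qed.

Lemma is_diff_dot {U : normedModType R} m (h k : U -> 'rV[R]_m) (x : U) :
  differentiable h x -> differentiable k x ->
  is_diff x (fun y => dot (h y) (k y))
    (fun v => dot (h x) ('d k x v) + dot ('d h x v) (k x)).
Proof.
pose B : {bilinear 'rV[R]_m -> 'rV[R]_m -> R} :=
  HB.pack (@dot R m) (bilinear_isBilinear.Build _ _ _ _ _ _ _ (dot_is_bilinear m)).
by apply: (@is_diff_bilinear _ _ _ _ B); exact: dot_continuous.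
Qed.

Lemma mulmxr_continuous m p (A : 'M[R]_(m, p)) :
  continuous (mulmxr A : 'rV[R]_m -> 'rV[R]_p).
Proof.
move=> v; apply: differentiable_continuous.
have -> : (mulmxr A : 'rV[R]_m -> 'rV[R]_p) =
    \sum_(i < m) (fun u : 'rV[R]_m => u 0 i *: row i A).
  by apply/funext => u; rewrite fct_sumE /= mulmx_sum_row.
apply: differentiable_sum => i.
exact/differentiableZl/differentiable_coord.
Qed.

(** * Closure properties of $C^k$ maps on an open set *)

Section CkOn.
Context {V : normedModType R} (U : set V) (openU : open U).

(** Openness of [U] makes equality on [U] an equality of germs, so the differentials agree on [U]
    and the induction continues. *)
Lemma Ck_on_eq {W : normedModType R} k (h g : V -> W) :
  (forall x, U x -> h x = g x) -> Ck_on k U h -> Ck_on k U g.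
Proof.
elim: k h g => [|k IH] h g hg /=.
  move=> ch x Ux; rewrite /prop_for /continuous_at -(hg x Ux).
  apply: cvg_trans (ch x Ux); apply: near_eq_cvg.
  by near do apply: hg; apply: open_nbhs_nbhs.
have near_hg x : U x -> \forall y \near x, h y = g y.
  by move=> Ux; near do apply: hg; apply: open_nbhs_nbhs.
move=> [dh ch]; split=> [x Ux|v].
  have ? := is_diff_near (near_hg x Ux) (dh x Ux).
  exact: ex_diff.
apply: IH (ch v) => x Ux.
by have [_ ->] := is_diff_near (near_hg x Ux) (dh x Ux).
Unshelve. all: by end_near. Qed.

(** Needed for products: each Leibniz term pairs a derivative with an underived factor, which must
    be lowered to the same order. *)
Lemma Ck_on_pred {W : normedModType R} k (h : V -> W) :
  Ck_on k.+1 U h -> Ck_on k U h.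
Proof.
elim: k h => [|k IH] h [dh ch]; first by move=> x /dh/differentiable_continuous.
by split=> // v; apply: IH.
Qed.

Lemma Ck_on_cst {W : normedModType R} k (a : W) : Ck_on k U (fun=> a).
Proof.
elim: k a => [|k IH] a /=; first by move=> x _; exact: cvg_cst.
split=> [x _|v]; first exact: differentiable_cst.
by under eq_fun do rewrite diff_cst; exact: IH.
Qed.

Lemma Ck_on_linear {W W' : normedModType R} k (L : {linear W -> W'})
    (h : V -> W) : continuous L -> Ck_on k U h -> Ck_on k U (L \o h).
Proof.
move=> cL; elim: k h => [|k IH] h /=.
  by move=> ch x Ux; apply: continuous_comp; [exact: ch | exact: cL].
move=> [dh ch].
have dL x : U x -> is_diff x (L \o h) (L \o 'd h x).
  move=> Ux; have dLx := linear_differentiable (h x) cL.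
  split; first exact: (differentiable_comp (dh x Ux) dLx).
  by rewrite (diff_comp (dh x Ux) dLx) diff_lin.
split=> [x /dL ?|v]; first exact: ex_diff.
by apply: Ck_on_eq (IH _ (ch v)) => x /dL [_ ->].
Qed.

Lemma Ck_onD {W : normedModType R} k (h g : V -> W) :
  Ck_on k U h -> Ck_on k U g -> Ck_on k U (fun x => h x + g x).
Proof.
elim: k h g => [|k IH] h g /=.
  by move=> ch cg x Ux; apply: continuousD; [exact: ch | exact: cg].
move=> [dh ch] [dg cg].
have dhg x : U x ->
    is_diff x (fun y => h y + g y) (fun v => 'd h x v + 'd g x v).
  by move=> Ux; split; [apply: differentiableD | apply: diffD]; auto.
split=> [x Ux|v]; first by have ? := dhg x Ux; exact: ex_diff.
apply: Ck_on_eq (IH _ _ (ch v) (cg v)) => x Ux.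
by rewrite (@diff_val _ _ _ _ _ _ _ (dhg x Ux)).
Qed.

Lemma Ck_onZ {W : normedModType R} k (a : V -> R) (h : V -> W) :
  Ck_on k U a -> Ck_on k U h -> Ck_on k U (fun x => a x *: h x).
Proof.
elim: k a h => [|k IH] a h.
  by move=> ca ch x Ux; apply: cvgZ; [exact: ca | exact: ch].
move=> aS hS; have [da ca] := aS; have [dh ch] := hS.
have dah x Ux := is_diff_scale (da x Ux) (dh x Ux).
split=> [x Ux|v]; first by have ? := dah x Ux; exact: ex_diff.
apply: (@Ck_on_eq _ _ (fun x => a x *: 'd h x v + 'd a x v *: h x)).
  by move=> x Ux; rewrite (@diff_val _ _ _ _ _ _ _ (dah x Ux)).
apply: Ck_onD; apply: IH; [exact: Ck_on_pred aS | exact: ch | exact: ca |].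
exact: Ck_on_pred hS.
Qed.

End CkOn.
End Differential.

(** * Change of charts and well-definedness of [tdiff] *)

Section Charts.
Context {R : realType} {n : nat} {M : topologicalType}.
Variable f : M -> 'rV[R]_n.+1.

(** An injective map has a row-free matrix, and the pseudo-inverse of such a matrix is a right
    inverse. *)
Lemma linear_inj_left_inverse m p (D : {linear 'rV[R]_m -> 'rV[R]_p}) :
  injective D -> exists A, cancel D (mulmxr A).
Proof.
move=> injD; exists (pinvmx (lin1_mx D)) => u.
rewrite /= -(mul_rV_lin1 D) mulmxKp //.
apply: inj_row_free => v; rewrite mul_rV_lin1 => Dv0.
by apply: injD; rewrite Dv0 linear0.
Qed.

Lemma chart_diff V psi x : is_chart f V psi -> V x ->
  differentiable (f \o psi) x.
Proof. by case=> _ _ _ _ [sm _] Vx; have [/(_ x Vx)] := sm 1%N. Qed.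

(* No smooth structure on M is given, so this replaces the smoothness of
   transition maps. *)
Lemma chart_transition V psi x V' psi' x' :
  is_chart f V psi -> is_chart f V' psi' -> V x -> V' x' -> psi x = psi' x' ->
  exists tau, [/\ tau x' = x, differentiable tau x' &
    \forall y \near x', psi (tau y) = psi' y].
Proof.
move=> cpsi cpsi' Vx Vx' xx'.
have dF := chart_diff cpsi Vx; have dF' := chart_diff cpsi' Vx'.
have [oV ipsi _ opsi [_ injF]] := cpsi; have [_ _ cpsi'' _ _] := cpsi'.
(* [psi] is open and [psi'] is continuous. This makes [tau] below both a genuine transition map near
   [x'] and continuous at [x']. *)
have nbhs_psi U : nbhs x U -> \forall y \near x', (psi @` (U `&` V)) (psi' y).
  rewrite nbhsE => -[B [oB Bx] BU]; apply: (cpsi'' _ Vx').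
  rewrite -xx'; have : nbhs (psi x) (psi @` (B `&` V)).
    apply: open_nbhs_nbhs; split; last by exists x.
    by apply: opsi; [exact: openI | move=> z []].
  by apply: filterS; apply: image_subset => z [/BU].
(* The default value [x] is taken only where [psi' y] lies outside the image of [psi], which does
   not happen near [x']. *)
pose tau y := xget x [set z | V z /\ psi z = psi' y].
have tau_psi z y : V z -> psi z = psi' y -> tau y = z.
  move=> Vz zy; rewrite /tau; case: xgetP => [w -> [Vw wy]|/(_ z) []//].
  by apply: ipsi; rewrite ?inE // wy zy.
have near_tau : \forall y \near x', psi (tau y) = psi' y.
  apply: filterS (nbhs_psi _ (@filterT _ _ _)) => y [z [_ Vz] zy].
  by rewrite (tau_psi z).
have tx' : tau x' = x by exact: tau_psi.
exists tau; split=> //.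
(* For a left inverse [A] of the differential of [f \o psi] at [x], the map [mulmxr A \o (f \o psi)]
   has differential [id] there, and its composite with [tau] is [mulmxr A \o (f \o psi')] near
   [x']. *)
have [A KA] := linear_inj_left_inverse (injF x Vx).
have cA := @mulmxr_continuous R _ _ A.
have dA v := linear_differentiable v cA.
have dAF : is_diff x (mulmxr A \o (f \o psi)) id.
  split; first exact: (differentiable_comp dF (dA _)).
  rewrite (diff_comp dF (dA _)) diff_lin //; apply/funext => u; exact: KA.
apply: (@differentiable_inverse _ _ _ _ _ (mulmxr A \o (f \o psi')) _ _ dAF).
- move=> U; rewrite tx' => /nbhs_psi; apply: filterS => y [z [Uz Vz] zy].
  by rewrite /= (tau_psi z).
- by [].
- by apply: filterS near_tau => y /= ->.
- exact: (differentiable_comp dF' (dA _)).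
Qed.

(** [L] is the differential of the transition map. It is chosen before [h], so that [f] and any
    other map transform by the same [L]. *)
Lemma chart_change V psi x V' psi' x' :
  is_chart f V psi -> is_chart f V' psi' -> V x -> V' x' -> psi x = psi' x' ->
  exists L : 'rV[R]_n -> 'rV[R]_n, forall (W : normedModType R) (h : M -> W),
    differentiable (h \o psi) x ->
    is_diff x' (h \o psi') ('d (h \o psi) x \o L).
Proof.
move=> cpsi cpsi' Vx Vx' xx'.
have [tau [tx' dtau near_tau]] := chart_transition cpsi cpsi' Vx Vx' xx'.
exists ('d tau x') => W h; rewrite -tx' => dh.
have near_h : \forall y \near x', ((h \o psi) \o tau) y = (h \o psi') y.
  by apply: filterS near_tau => y /= ->.
have [dh'' Eh''] := is_diff_near near_h (differentiable_comp dtau dh).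
split; first exact: dh''.
exact: (etrans Eh'' (diff_comp dtau dh)).
Qed.

(** [tangent] provides some chart for each vector; this allows all tangent vectors at a point to be
    represented in one chart. *)
Lemma chart_tangent V psi x v : is_chart f V psi -> V x ->
  tangent f (psi x) v -> exists u, 'd (f \o psi) x u = v.
Proof.
move=> cpsi Vx [V' [psi' [x' [cpsi' Vx' xx' [u <-]]]]].
have [L /(_ _ f (chart_diff cpsi Vx)) [_ EL]] :=
  chart_change cpsi cpsi' Vx Vx' (esym xx').
by exists (L u); exact: (esym (congr1 (@^~ u) EL)).
Qed.

Lemma chart_tdiff (W : normedModType R) (h : M -> W) V psi x u :
  is_chart f V psi -> V x -> differentiable (h \o psi) x ->
  tdiff f h (psi x) ('d (f \o psi) x u) = 'd (h \o psi) x u.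
Proof.
move=> cpsi Vx dh; rewrite /tdiff.
case: xgetP => [w -> |/(_ ('d (h \o psi) x u)) []]; last first.
  by exists V, psi, x, u.
move=> [V' [psi' [x' [u' [cpsi' Vx' xx' Ef <-]]]]].
have [L dL] := chart_change cpsi cpsi' Vx Vx' (esym xx').
have [_ EhL] := dL _ h dh; have [_ EfL] := dL _ f (chart_diff cpsi Vx).
have [_ _ _ _ [_ injF]] := cpsi.
(* Both coordinate vectors represent the same tangent vector, so injectivity of the differential of
   [f \o psi] identifies them. *)
have Lu' : L u' = u.
  by apply: (injF x Vx); rewrite -Ef; exact: (esym (congr1 (@^~ u') EfL)).
by rewrite -Lu'; exact: (congr1 (@^~ u') EhL).
Qed.

End Charts.

(** * Algebra of the dot product and coordinates *)

Section Dot.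
Context {R : realType} {m : nat}.
Implicit Types u v w : 'rV[R]_m.

Lemma dotC u v : dot u v = dot v u.
Proof. by rewrite /dot; apply: eq_bigr => i _; rewrite mulrC. Qed.

Lemma dotDl u v w : dot (u + v) w = dot u w + dot v w.
Proof. by rewrite /dot -big_split; apply: eq_bigr => i _; rewrite mxE mulrDl. Qed.

Lemma dotZl (a : R) u v : dot (a *: u) v = a * dot u v.
Proof. by rewrite /dot mulr_sumr; apply: eq_bigr => i _; rewrite mxE mulrA. Qed.

Lemma dotBl u v w : dot (u - v) w = dot u w - dot v w.
Proof. by rewrite dotDl -scaleN1r dotZl mulN1r. Qed.

Lemma dotBr u v w : dot u (v - w) = dot u v - dot u w.
Proof. by rewrite dotC dotBl !(dotC _ u). Qed.

Lemma dotZr (a : R) u v : dot u (a *: v) = a * dot u v.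
Proof. by rewrite dotC dotZl dotC. Qed.

Lemma dot_delta u i : dot u (delta_mx 0 i) = u 0 i.
Proof.
rewrite /dot (bigD1 i) //= mxE !eqxx mulr1 big1 ?addr0 // => j ji.
by rewrite mxE (negPf ji) andbF mulr0.
Qed.

Lemma coord_is_linear (i : 'I_m) : linear (fun u => u 0 i).
Proof. by move=> a u v; rewrite !mxE. Qed.

Definition coord_linear (i : 'I_m) : {linear 'rV[R]_m -> R} :=
  HB.pack (fun u : 'rV[R]_m => u 0 i)
    (GRing.isLinear.Build _ _ _ _ _ (coord_is_linear i)).

Lemma coord_linear_continuous i : continuous (coord_linear i).
Proof. exact: coord_continuous. Qed.

End Dot.

(** * Calculus of smooth maps on the hypersurface and its tangent spaces *)

Section Calculus.
Context {R : realType} {n : nat} {M : topologicalType}.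
Variable f : M -> 'rV[R]_n.+1.

Lemma smooth_diff (W : normedModType R) (h : M -> W) V psi x :
  smooth f h -> is_chart f V psi -> V x -> differentiable (h \o psi) x.
Proof. by move=> sh cpsi Vx; have [/(_ x Vx)] := sh _ _ cpsi 1%N. Qed.

Lemma smooth_immersion : smooth f f.
Proof. by move=> V psi [_ _ _ _ []]. Qed.

Lemma smooth_cst (W : normedModType R) (a : W) : smooth f (fun=> a).
Proof. by move=> V psi _ k; exact: Ck_on_cst. Qed.

Lemma smooth_linear (W W' : normedModType R) (L : {linear W -> W'})
    (h : M -> W) : continuous L -> smooth f h -> smooth f (fun p => L (h p)).
Proof.
move=> cL sh V psi cpsi k; have [oV _ _ _ _] := cpsi.
exact: (Ck_on_linear oV cL (sh _ _ cpsi k)).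
Qed.

Lemma smoothD (W : normedModType R) (h g : M -> W) :
  smooth f h -> smooth f g -> smooth f (fun p => h p + g p).
Proof.
move=> sh sg V psi cpsi k; have [oV _ _ _ _] := cpsi.
exact: (Ck_onD oV (sh _ _ cpsi k) (sg _ _ cpsi k)).
Qed.

Lemma smoothZ (W : normedModType R) (a : M -> R) (h : M -> W) :
  smooth f a -> smooth f h -> smooth f (fun p => a p *: h p).
Proof.
move=> sa sh V psi cpsi k; have [oV _ _ _ _] := cpsi.
exact: (Ck_onZ oV (sa _ _ cpsi k) (sh _ _ cpsi k)).
Qed.

Lemma smoothN (W : normedModType R) (h : M -> W) :
  smooth f h -> smooth f (fun p => - h p).
Proof.
move=> sh; have -> : (fun p => - h p) = (fun p => (-1 : R) *: h p).
  by apply/funext => p; rewrite scaleN1r.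
by apply: smoothZ; first exact: smooth_cst.
Qed.

Lemma smooth_coord m (h : M -> 'rV[R]_m) i :
  smooth f h -> smooth f (fun p => h p 0 i).
Proof. exact/(smooth_linear (L := coord_linear i))/coord_linear_continuous. Qed.

Lemma smooth_sum (W : normedModType R) m (h : 'I_m -> M -> W) :
  (forall i, smooth f (h i)) -> smooth f (fun p => \sum_(i < m) h i p).
Proof.
move=> sh; have -> : (fun p => \sum_(i < m) h i p) = \sum_(i < m) h i.
  by apply/funext => p; rewrite fct_sumE.
apply: big_ind => //; first exact: smooth_cst.
by move=> g k; exact: smoothD.
Qed.

Lemma tangentB p v w : tangent f p v -> tangent f p w -> tangent f p (v - w).
Proof.
move=> [V [psi [x [cpsi Vx <- [u <-]]]]] /(chart_tangent cpsi Vx) [u' <-].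
by exists V, psi, x; split=> //; exists (u - u'); rewrite linearB.
Qed.

Lemma tdiff_subv (W : normedModType R) (h : M -> W) p v w : smooth f h ->
  tangent f p v -> tangent f p w ->
  tdiff f h p (v - w) = tdiff f h p v - tdiff f h p w.
Proof.
move=> sh [V [psi [x [cpsi Vx <- [u <-]]]]] /(chart_tangent cpsi Vx) [u' <-].
have dh := smooth_diff sh cpsi Vx.
by rewrite -linearB !(chart_tdiff _ cpsi Vx dh) linearB.
Qed.

Lemma tdiff_immersion p v : tangent f p v -> tdiff f f p v = v.
Proof.
move=> [V [psi [x [cpsi Vx <- [u <-]]]]].
exact: (chart_tdiff u cpsi Vx (chart_diff cpsi Vx)).
Qed.

(** Reduces each rule for [tdiff] to the corresponding rule for differentials in a single chart. *)
Lemma tdiff_is_diff (W : normedModType R) (h : M -> W) V psi x u dh :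
  is_chart f V psi -> V x -> is_diff x (h \o psi) dh ->
  tdiff f h (psi x) ('d (f \o psi) x u) = dh u.
Proof.
move=> cpsi Vx [dfh Edh]; rewrite (chart_tdiff u cpsi Vx dfh).
exact: (congr1 (@^~ u) Edh).
Qed.

Lemma tdiff_cst (W : normedModType R) (a : W) p v :
  tangent f p v -> tdiff f (fun=> a) p v = 0.
Proof.
move=> [V [psi [x [cpsi Vx <- [u <-]]]]].
exact: (tdiff_is_diff _ cpsi Vx (is_diff_cst a x)).
Qed.

Lemma tdiff_linear (W W' : normedModType R) (L : {linear W -> W'})
    (h : M -> W) p v : continuous L -> smooth f h -> tangent f p v ->
  tdiff f (fun q => L (h q)) p v = L (tdiff f h p v).
Proof.
move=> cL sh [V [psi [x [cpsi Vx <- [u <-]]]]].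
have dh := smooth_diff sh cpsi Vx.
have dL := linear_differentiable ((h \o psi) x) cL.
rewrite (chart_tdiff u cpsi Vx dh).
apply: (@tdiff_is_diff _ _ _ _ _ _ (L \o 'd (h \o psi) x) cpsi Vx).
split; first exact: (differentiable_comp dh dL).
by apply: (etrans (diff_comp dh dL)); rewrite diff_lin.
Qed.

Lemma tdiff_coord m (h : M -> 'rV[R]_m) i p v : smooth f h ->
  tangent f p v -> tdiff f (fun q => h q 0 i) p v = tdiff f h p v 0 i.
Proof. exact/(tdiff_linear (L := coord_linear i))/coord_linear_continuous. Qed.

Lemma tdiffN (W : normedModType R) (h : M -> W) p v : smooth f h ->
  tangent f p v -> tdiff f (fun q => - h q) p v = - tdiff f h p v.
Proof.
move=> sh [V [psi [x [cpsi Vx <- [u <-]]]]].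
have dh := smooth_diff sh cpsi Vx; rewrite (chart_tdiff u cpsi Vx dh).
exact: (tdiff_is_diff _ cpsi Vx (is_diffN (differentiableP dh))).
Qed.

Lemma tdiffD (W : normedModType R) (h g : M -> W) p v : smooth f h ->
  smooth f g -> tangent f p v ->
  tdiff f (fun q => h q + g q) p v = tdiff f h p v + tdiff f g p v.
Proof.
move=> sh sg [V [psi [x [cpsi Vx <- [u <-]]]]].
have dh := smooth_diff sh cpsi Vx; have dg := smooth_diff sg cpsi Vx.
rewrite (chart_tdiff u cpsi Vx dh) (chart_tdiff u cpsi Vx dg).
exact: (tdiff_is_diff _ cpsi Vx
  (is_diffD (differentiableP dh) (differentiableP dg))).
Qed.

Lemma tdiffZ (W : normedModType R) (a : M -> R) (h : M -> W) p v :
  smooth f a -> smooth f h -> tangent f p v ->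
  tdiff f (fun q => a q *: h q) p v =
  a p *: tdiff f h p v + tdiff f a p v *: h p.
Proof.
move=> sa sh [V [psi [x [cpsi Vx <- [u <-]]]]].
have da := smooth_diff sa cpsi Vx; have dh := smooth_diff sh cpsi Vx.
rewrite (chart_tdiff u cpsi Vx da) (chart_tdiff u cpsi Vx dh).
exact: (tdiff_is_diff _ cpsi Vx (is_diff_scale da dh)).
Qed.

Lemma tdiff_dot m (h g : M -> 'rV[R]_m) p v :
  smooth f h -> smooth f g -> tangent f p v ->
  tdiff f (fun q => dot (h q) (g q)) p v =
  dot (tdiff f h p v) (g p) + dot (h p) (tdiff f g p v).
Proof.
move=> sh sg [V [psi [x [cpsi Vx <- [u <-]]]]].
have dh := smooth_diff sh cpsi Vx; have dg := smooth_diff sg cpsi Vx.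
rewrite (chart_tdiff u cpsi Vx dh) (chart_tdiff u cpsi Vx dg) addrC.
exact: (tdiff_is_diff _ cpsi Vx (is_diff_dot dh dg)).
Qed.

Lemma vector_fieldB X Y : vector_field f X -> vector_field f Y ->
  vector_field f (fun p => X p - Y p).
Proof.
move=> [sX tX] [sY tY]; split=> [|p]; last exact: tangentB.
by apply: smoothD => //; exact: smoothN.
Qed.

(** By dimension: the tangent space is the row space of the Jacobian, of rank [n], and lies in the
    orthogonal complement of [nu], also of rank [n]. *)
Lemma tangent_of_orthogonal p (nu v : 'rV[R]_n.+1) : is_hypersurface f ->
  nu != 0 -> (forall w, tangent f p w -> dot nu w = 0) -> dot nu v = 0 ->
  tangent f p v.
Proof.
move=> [_ _ /(_ p) [V [psi [cpsi [x Vx xp]]]]] nu0 nuT nuv.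
have [_ _ _ _ [_ /(_ x Vx) injF]] := cpsi.
pose J := lin1_mx ('d (f \o psi) x).
have dotE w : w *m nu^T = 0 <-> dot nu w = 0.
  rewrite dotC; split=> [/matrixP/(_ 0 0)|E].
    by rewrite !mxE => <-; apply: eq_bigr => i _; rewrite mxE.
  apply/matrixP => i j; rewrite !ord1 !mxE -[RHS]E.
  by apply: eq_bigr => k _; rewrite mxE.
have Jnu : (J <= kermx nu^T)%MS.
  apply/sub_kermxP/row_matrixP => i; rewrite row0 row_mul; apply/dotE.
  rewrite rowE mul_rV_lin1; apply: nuT.
  by exists V, psi, x; split=> //; exists (delta_mx 0 i).
have rJ : row_free J.
  apply: inj_row_free => u; rewrite mul_rV_lin1 => Du0.
  by apply: injF; rewrite Du0 linear0.
have rnu : \rank (kermx nu^T) = n.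
  by rewrite mxrank_ker mxrank_tr rank_rV nu0 subn1.
have [_] := mxrank_leqif_eq Jnu; rewrite rnu (eqP rJ) eqxx => /esym/andP [_ nuJ].
have /submxP [u Eu] : (v <= J)%MS.
  by apply: submx_trans nuJ; apply/sub_kermxP/dotE.
exists V, psi, x; split=> //; exists u.
by rewrite Eu mul_rV_lin1.
Qed.

End Calculus.

(** Applied to $\nabla_X Y - \nabla_Y X = D_X Y - D_Y X$, it makes the difference of two connections
    with equal torsion symmetric. *)
Lemma eq_subr_swap (V : zmodType) (a b c d : V) :
  a - b = c - d -> a - c = b - d.
Proof. by move/eqP; rewrite subr_eq addrAC -addrA addrC -subr_eq => /eqP. Qed.

(** * Torsion-freeness tested on vector-valued maps *)

Section LeviCivita.
Context {R : realType} {n : nat} {M : topologicalType}.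
Variable f : M -> 'rV[R]_n.+1.

(** [torsion_free] is applied to each coordinate of [h]. The first derivatives are assumed smooth so
    that taking coordinates commutes with the second derivative. *)
Lemma torsion_free_commutator m nabla X Y (h : M -> 'rV[R]_m) p :
  linear_connection f nabla -> torsion_free f nabla ->
  vector_field f X -> vector_field f Y -> smooth f h ->
  smooth f (dirder f X h) -> smooth f (dirder f Y h) ->
  dirder f X (dirder f Y h) p - dirder f Y (dirder f X h) p =
  tdiff f h p (nabla X Y p) - tdiff f h p (nabla Y X p).
Proof.
move=> [nablaV _] tf vX vY sh sXh sYh.
have [tX tY] := (vX.2, vY.2).
have tXY := (nablaV _ _ vX vY).2; have tYX := (nablaV _ _ vY vX).2.
have dirder_coord Z i : (forall q, tangent f q (Z q)) ->
    dirder f Z (fun q => h q 0 i) = fun q => dirder f Z h q 0 i.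
  by move=> tZ; apply/funext => q; rewrite /dirder tdiff_coord.
have tB := tangentB (tXY p) (tYX p).
apply: (etrans _ (tdiff_subv sh (tXY p) (tYX p))); apply/rowP => i.
have := tf X Y _ vX vY (smooth_coord i sh) p.
rewrite (dirder_coord X i tX) (dirder_coord Y i tY).
rewrite [dirder f (_ \- _) _ _](tdiff_coord i sh tB).
rewrite [dirder f X _ _](tdiff_coord i sYh (tX p)).
rewrite [dirder f Y _ _](tdiff_coord i sXh (tY p)).
move=> E; rewrite mxE [X in _ + X]mxE; exact: (esym E).
Qed.

(* The coordinates of the immersion are smooth functions on [M], and enough to
   determine a tangent vector. *)
Lemma torsion_free_bracket nabla X Y p : linear_connection f nabla ->
  torsion_free f nabla -> vector_field f X -> vector_field f Y ->
  nabla X Y p - nabla Y X p = dirder f X Y p - dirder f Y X p.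
Proof.
move=> lc tf vX vY; have [nablaV _] := lc.
have fE Z : vector_field f Z -> dirder f Z f = Z.
  by move=> [_ tZ]; apply/funext => q; exact: tdiff_immersion.
have := torsion_free_commutator p lc tf vX vY (@smooth_immersion _ _ _ f).
rewrite (fE X vX) (fE Y vY) => H.
have := H vX.1 vY.1.
rewrite (tdiff_immersion ((nablaV _ _ vX vY).2 p)).
by rewrite (tdiff_immersion ((nablaV _ _ vY vX).2 p)).
Qed.

End LeviCivita.

(** * The Gauss formula, the symmetry of the second form and the Codazzi equation *)

Section Hypersurface.
Context {R : realType} {n : nat} {M : topologicalType}.
Variables (f : M -> 'rV[R]_n.+1) (hM : is_hypersurface f).
Variables (N : M -> 'rV[R]_n.+1) (hN : unit_normal f N).
Variable nabla : @operator R n M.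
Hypothesis hnabla : levi_civita f first_form nabla.

Let vf := vector_field f.

Let sN : smooth f N. Proof. by case: hN. Qed.
Let NN p : dot (N p) (N p) = 1. Proof. by case: hN. Qed.
Let Nt p v : tangent f p v -> dot (N p) v = 0.
Proof. by case: hN => _ _; apply. Qed.
Let nablaV X Y : vf X -> vf Y -> vf (nabla X Y).
Proof. by case: hnabla => -[H _] _ _; exact: H. Qed.

Lemma tangent_normalP p v : tangent f p v <-> dot (N p) v = 0.
Proof.
split=> [/Nt//|Nv]; apply: (tangent_of_orthogonal hM _ (@Nt p) Nv).
apply: contra_eq_neq (NN p) => ->.
by rewrite -[0 : 'rV_ _](scale0r 0) dotZl mul0r eq_sym oner_neq0.
Qed.

Definition tproj (i : 'I_n.+1) : M -> 'rV[R]_n.+1 :=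
  fun p => delta_mx 0 i - N p 0 i *: N p.

Lemma tproj_vector_field i : vf (tproj i).
Proof.
split=> [|p].
  apply: smoothD; first exact: smooth_cst.
  by apply: smoothN; apply: smoothZ => //; exact: smooth_coord.
by apply/tangent_normalP; rewrite dotBr dotZr NN mulr1 dot_delta subrr.
Qed.

(** For tangent [u] the last term vanishes, so pairing with the fields [tproj i] recovers the
    coordinates of [u]. *)
Lemma dot_tproj u p i : dot u (tproj i p) = u 0 i - N p 0 i * dot (N p) u.
Proof. by rewrite dotBr dotZr dot_delta dotC. Qed.

(* The uniqueness part of the Koszul argument: [D] is metric and its torsion is
   the bracket as well, so [<nabla_X Y - D_X Y, Z>] is symmetric in [X, Y] and
   antisymmetric in [Y, Z]. *)
Lemma levi_civita_dot X Y Z p : vf X -> vf Y -> vf Z ->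
  dot (nabla X Y p) (Z p) = dot (dirder f X Y p) (Z p).
Proof.
have [lc tf par] := hnabla.
pose S X Y Z := dot (nabla X Y p - dirder f X Y p) (Z p).
have S_sym U V W : vf U -> vf V -> S U V W = S V U W.
  move=> vU vV; have := eq_subr_swap (torsion_free_bracket p lc tf vU vV).
  exact: (congr1 (fun u => dot u (W p))).
have S_anti U V W : vf U -> vf V -> vf W -> S U V W = - S U W V.
  move=> vU vV vW; rewrite /S.
  have := etrans (esym (tdiff_dot vV.1 vW.1 (vU.2 p))) (par U V W vU vV vW p).
  rewrite /first_form -/(dirder f U V p) -/(dirder f U W p).
  move: (dirder f U V p) (dirder f U W p) (nabla U V p) (nabla U W p).
  move=> d d' a a'; rewrite !dotBl !(dotC (V p)); lra.
move=> vX vY vZ; suff S0 : S X Y Z = 0.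
  move: S0; rewrite /S; move: (nabla X Y p) (dirder f X Y p) => a d.
  by rewrite dotBl => /eqP; rewrite subr_eq0 => /eqP.
(* The arguments run through $XYZ, YXZ, YZX, ZYX, ZXY, XZY, XYZ$; three of the six transpositions
   change the sign. *)
have : S X Y Z = - S X Y Z.
  by rewrite {1}S_sym // S_anti // S_sym // S_anti // opprK S_sym // S_anti.
lra.
Qed.

Lemma gauss_formula X Y p : vf X -> vf Y ->
  nabla X Y p = dirder f X Y p - dot (N p) (dirder f X Y p) *: N p.
Proof.
move=> vX vY; apply/rowP => i; rewrite !mxE.
have := levi_civita_dot p vX vY (tproj_vector_field i).
rewrite !dot_tproj Nt ?mulr0 ?subr0 => [->|]; last exact: (nablaV vX vY).2.
by rewrite mulrC.
Qed.

(** Differentiate $\langle N, N\rangle = 1$. *)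
Lemma normal_dirder_normal X p : vf X -> dot (N p) (dirder f X N p) = 0.
Proof.
move=> vX; have := tdiff_dot sN sN (vX.2 p).
have -> : (fun q => dot (N q) (N q)) = fun=> 1 by apply/funext => q.
rewrite tdiff_cst; last exact: vX.2.
rewrite dotC -/(dirder f X N p); lra.
Qed.

(* [D_X N] is smooth because it is [- sum_i N_i nabla_X (tproj i)]. *)
Lemma smooth_dirder_normal X : vf X -> smooth f (dirder f X N).
Proof.
move=> vX; have -> : dirder f X N =
    fun p => - \sum_(i < n.+1) N p 0 i *: nabla X (tproj i) p.
  apply/funext => p.
  (* $D_X$ of [tproj i] is $-(N_i D_X N + (D_X N)_i N)$, and the Gauss formula removes the part
     along $N$. Weighting by $N_i$ and summing then gives $-D_X N$, as $\sum_i N_i^2 = 1$. *)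
  have E i : nabla X (tproj i) p = - N p 0 i *: dirder f X N p.
    rewrite gauss_formula //; last exact: tproj_vector_field.
    have -> : dirder f X (tproj i) p =
        - (N p 0 i *: dirder f X N p + dirder f X N p 0 i *: N p).
      have sNi := smooth_coord i sN; have tX := vX.2 p.
      rewrite /dirder tdiffD //; [|exact: smooth_cst|]; last first.
        by apply: smoothN; exact: smoothZ.
      by rewrite tdiff_cst // add0r tdiffN ?tdiffZ ?tdiff_coord //; exact: smoothZ.
    rewrite -scaleN1r dotZr (dotC (N p)) dotDl !dotZl (dotC _ (N p)) NN.
    rewrite normal_dirder_normal // mulr0 add0r mulr1 scaleN1r.
    by rewrite mulN1r scaleNr opprD opprK subrK scaleNr.
  under eq_bigr => i _ do rewrite E scaleNr scalerN scalerA.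
  by rewrite sumrN opprK -scaler_suml -/(dot (N p) (N p)) NN scale1r.
apply: smoothN; apply: smooth_sum => i; apply: smoothZ; first exact: smooth_coord.
exact: (nablaV vX (tproj_vector_field i)).1.
Qed.

Local Notation b := (second_form f N).

(** Differentiate $\langle N, Y\rangle = 0$ along $X$. *)
Lemma second_form_normal X Y p : vf X -> vf Y ->
  b p (X p) (Y p) = dot (N p) (dirder f X Y p).
Proof.
move=> vX vY; have := tdiff_dot sN vY.1 (vX.2 p).
have -> : (fun q => dot (N q) (Y q)) = fun=> 0.
  by apply/funext => q; apply: Nt; exact: vY.2.
rewrite tdiff_cst; last exact: vX.2.
rewrite /second_form /dirder; lra.
Qed.

(** The difference of the two sides is $\langle N, D_X Y - D_Y X\rangle$, and the bracket is tangent
    because it equals $\nabla_X Y - \nabla_Y X$. *)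
Lemma second_form_sym X Y p : vf X -> vf Y ->
  b p (X p) (Y p) = b p (Y p) (X p).
Proof.
move=> vX vY; have [lc tf _] := hnabla.
rewrite (second_form_normal p vX vY) (second_form_normal p vY vX).
have := Nt (tangentB ((nablaV vX vY).2 p) ((nablaV vY vX).2 p)).
rewrite (torsion_free_bracket p lc tf vX vY).
move: (dirder f X Y p) (dirder f Y X p) => d d'.
by rewrite dotBr => /eqP; rewrite subr_eq0 => /eqP.
Qed.

(* [X b(Y, Z) - Y b(X, Z)] computed once from [b = - <dN, .>] and once from
   [nablabar b = 0]; the terms in [[X, Y]] cancel by the torsion-freeness of
   [nablabar]. *)
Lemma codazzi nablabar X Y Z p : levi_civita f b nablabar ->
  vf X -> vf Y -> vf Z ->
  b p (Y p) (nablabar X Z p - nabla X Z p) =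
  b p (X p) (nablabar Y Z p - nabla Y Z p).
Proof.
move=> [lc tf par] vX vY vZ.
(* Leibniz produces $D_U Z$; it may be replaced by $\nabla_U Z$ because $D_V N$ is orthogonal to
   $N$. *)
have derb U V : vf U -> vf V -> dirder f U (fun q => b q (V q) (Z q)) p =
    - dot (dirder f U (dirder f V N) p) (Z p) -
    dot (dirder f V N p) (nabla U Z p).
  move=> vU vV; have sVN := smooth_dirder_normal vV.
  have -> : (fun q => b q (V q) (Z q)) = fun q => dot (- dirder f V N q) (Z q).
    by apply/funext => q; rewrite /second_form -(scaleN1r (dirder _ _ _ _)) dotZl mulN1r.
  apply: (etrans (tdiff_dot (smoothN sVN) vZ.1 (vU.2 p))).
  rewrite (tdiffN sVN (vU.2 p)) -/(dirder f U Z p) -/(dirder f U (dirder f V N) p).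
  rewrite (gauss_formula p vU vZ); have := normal_dirder_normal p vV.
  move: (dirder f U (dirder f V N) p) (dirder f V N p) (dirder f U Z p).
  move=> d e d' Ne; rewrite dotBr dotZr (dotC e (N p)) Ne mulr0 subr0.
  by rewrite -!(scaleN1r (_ : 'rV__)) !dotZl !mulN1r.
have := torsion_free_commutator p lc tf vX vY sN
  (smooth_dirder_normal vX) (smooth_dirder_normal vY).
have := par X Y Z vX vY vZ p; have := par Y X Z vY vX vZ p.
rewrite (derb _ _ vX vY) (derb _ _ vY vX) /second_form.
rewrite -/(dirder f X N p) -/(dirder f Y N p).
move: (dirder f X (dirder f Y N) p) (dirder f Y (dirder f X N) p)
  (tdiff f N p (nablabar X Y p)) (tdiff f N p (nablabar Y X p))
  (dirder f X N p) (dirder f Y N p)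
  (nablabar X Z p) (nablabar Y Z p) (nabla X Z p) (nabla Y Z p).
(* [Ex] reads $\langle d,Z\rangle + \langle y,bx\rangle = \langle t,Z\rangle + \langle y,ax\rangle$
   up to sign, and [Ey] is its analogue with $X$ and $Y$ exchanged. Subtracting them and using $d -
   d' = t - t'$ gives the claim. *)
move=> d d' t t' x y ax ay bx by_ Ey Ex /(congr1 (fun u => dot u (Z p))).
rewrite !dotBl !dotBr; lra.
Qed.

End Hypersurface.

Theorem proposition2p3 (R : realType) (n : nat) (hn : (2 <= n)%N)
    (M : topologicalType) (f : M -> 'rV[R]_n.+1) (hM : is_hypersurface f)
    (N : M -> 'rV[R]_n.+1) (hN : unit_normal f N)
    (hrank : forall p : M, has_rank_at f (second_form f N) p n)
    (nabla nablabar : (M -> 'rV[R]_n.+1) -> (M -> 'rV[R]_n.+1) -> M -> 'rV[R]_n.+1)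
    (hnabla : levi_civita f first_form nabla)
    (hnablabar : levi_civita f (second_form f N) nablabar) :
  formal_frobenius f (second_form f N)
    (fun X Y p => nablabar X Y p - nabla X Y p).
Proof.
move=> X Y Z vX vY vZ.
have [[lc tf _] [lcb tfb _]] := (hnabla, hnablabar).
have A_sym U V p : vector_field f U -> vector_field f V ->
    nablabar U V p - nabla U V p = nablabar V U p - nabla V U p.
  move=> vU vV; apply: eq_subr_swap.
  (* Both torsion conditions identify the antisymmetrised connection with $D_X Y - D_Y X$. *)
  exact: (etrans (torsion_free_bracket p lcb tfb vU vV)
    (esym (torsion_free_bracket p lc tf vU vV))).
split=> p; last exact: A_sym.
(* The symmetry of $b$ is available on vector fields, so $A(X,Y)$ has to be one. Then $b(Z, A(X,Y))
   = b(X, A(Z,Y))$ is Codazzi for $X, Z, Y$. *)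
have vA := vector_fieldB (lcb.1 _ _ vX vY) (lc.1 _ _ vX vY).
rewrite (second_form_sym hN hnabla p vA vZ) (A_sym Y Z) //.
exact: (codazzi hM hN hnabla p hnablabar vX vZ vY).
Qed.
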